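(* Let $S$ be a semigroup generated by $d$ elements ($d$ a natural number). Suppose that $S$ has a non-central (two-sided) ideal $I$, i.e. $I\not\subseteq Z(S)$, such that $IS\subseteq Z(S)$ and $SI\subseteq Z(S)$. If the commuting graph $\Gamma(S)$ is connected, then its diameter $D$ satisfies $D\leq d+2$.
   Context: For a semigroup $S$, $Z(S)$ denotes its center, i.e. the set of elements commuting with every element of $S$. The commuting graph $\Gamma(S)$ is the simple graph with vertex set $S\setminus Z(S)$ in which two distinct vertices are joined by an edge if and only if they commute in $S$. The diameter of a connected graph is the maximal distance between two vertices, distance being the number of edges in a shortest path. Here $IS=\{xs : x\in I, s\in S\}$ and $SI=\{sx : s\in S, x\in I\}$. *)

(* Defs.v *)
From HB Require Import structures.
From mathcomp Require Import all_boot.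
From mathcomp Require Import boolp classical_sets.

Set Implicit Arguments.
Unset Strict Implicit.
Unset Printing Implicit Defensive.

Local Open Scope classical_set_scope.

Section Semigroup.
Variable S : semigroupType.
Implicit Types A B T I : set S.

Definition setmul A B : set S := [set (x * y)%g | x in A & y in B].

Definition center : set S := [set z | forall s, commute z s].

Definition subsemigroup T : Prop := setmul T T `<=` T.

Definition generates A : Prop := smallest subsemigroup A = setT.

(* Two-sided ideal. *)
Definition ideal I : Prop :=
  [/\ I !=set0, setmul I setT `<=` I & setmul setT I `<=` I].

End Semigroup.

Arguments center S : clear implicits.

(* Simple graphs given by their adjacency relation on a vertex type that may be
   infinite. *)
Section Graph.
Variables (V : eqType) (e : rel V).

(* [path e x p] alone only says that x :: p is a walk; [uniq] makes it a path. *)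
Definition joined_by_path (x y : V) (n : nat) : Prop :=
  exists p : seq V, [/\ path e x p, uniq (x :: p), last x p = y & size p = n].

Definition graph_connected : Prop :=
  forall x y : V, exists n, joined_by_path x y n.

Definition is_distance (x y : V) (n : nat) : Prop :=
  joined_by_path x y n /\ forall m, joined_by_path x y m -> n <= m.

(* The maximum has to be attained, so a graph with unbounded distances has no
   diameter in this sense. *)
Definition is_diameter (D : nat) : Prop :=
  (exists x y, is_distance x y D) /\
  forall x y n, is_distance x y n -> n <= D.

Lemma is_diameter_unique (D D' : nat) :
  is_diameter D -> is_diameter D' -> D = D'.
Proof.
move=> [[x [y dxy]] leD] [[x' [y' dxy']] leD'].
by apply/eqP; rewrite eqn_leq (leD' _ _ _ dxy) (leD _ _ _ dxy').
Qed.

End Graph.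

Definition noncentral (S : semigroupType) := {x : S | x \notin center S}.

Definition commuting_graph (S : semigroupType) : rel (noncentral S) :=
  fun x y => (x != y) && (val x * val y == val y * val x)%g.

Arguments commuting_graph S : clear implicits.

(* Main.v *)
Require Import Defs.
From HB Require Import structures.
From mathcomp Require Import all_boot.
From mathcomp Require Import boolp classical_sets.

Set Implicit Arguments.
Unset Strict Implicit.
Unset Printing Implicit Defensive.

Local Open Scope classical_set_scope.

(** Fix a non-central element [c] of the ideal [I].  For all [s] and [t], the
    centrality of [c s] and of [t c] gives [c s t = t c s = s t c], so [c]
    commutes with every product ([ideal_commutes_mul]).  An element that is not
    a product of two elements is a generator
    ([generates_generator_or_product]); hence at most [d] vertices of the
    commuting graph lie outside the closed neighbourhood of [c].

    The rest is graph theory ([distance_le_of_hub]): two vertices in the closed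
    neighbourhood of [c] are at distance at most 2, so a shortest path contains
    at most three of them.  It has therefore at most [d + 3] vertices, that is,
    length at most [d + 2].  Finally, distances bounded by a constant attain
    their maximum ([diameter_of_bound]). *)

Section Graph.
Variables (V : eqType) (e : rel V).

Lemma joined_by_shorter_path (x : V) (p : seq V) :
  path e x p -> exists2 m, joined_by_path e x (last x p) m & m <= size p.
Proof.
move=> exp; case: (shortenP exp) => p' exp' Up' sub_p'.
exists (size p'); first by exists p'.
by apply: uniq_leq_size => //; case/andP: Up'.
Qed.

(** Replacing the stretch of a shortest path between its vertices of indices
    [i] and [j] by the walk [q] cannot make the path shorter. *)
Lemma geodesic_shortcut (x : V) (p q : seq V) (i j : nat) :
    path e x p -> is_distance e x (last x p) (size p) ->
    i <= j <= size p ->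
    path e (nth x (x :: p) i) q ->
    last (nth x (x :: p) i) q = nth x (x :: p) j ->
  j <= i + size q.
Proof.
move=> exp [_ min_p] /andP[le_ij le_jp] eq_q last_q.
have last_take k : k <= size p -> last x (take k p) = nth x (x :: p) k.
  move=> le_kp; rewrite (last_nth x) size_takel //.
  by rewrite -[x :: take k p]/(take k.+1 (x :: p)) nth_take.
have exr : path e x (take i p ++ q ++ drop j p).
  rewrite !cat_path take_path // last_take ?(leq_trans le_ij) // eq_q last_q /=.
  by move: exp; rewrite -{1}(cat_take_drop j p) cat_path last_take // => /andP[].
have last_r : last x (take i p ++ q ++ drop j p) = last x p.
  rewrite !last_cat last_take ?(leq_trans le_ij) // last_q -last_take //.
  by rewrite -last_cat cat_take_drop.
have [m] := joined_by_shorter_path exr.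
rewrite last_r => /min_p le_pm /(leq_trans le_pm).
rewrite !size_cat size_takel ?(leq_trans le_ij) // size_drop addnA.
by rewrite -(leq_add2r (size p - j) j) subnKC.
Qed.

Lemma walk_via_hub (c u v : V) :
    symmetric e -> (u == c) || e c u -> (v == c) || e c v ->
  exists q, [/\ path e u q, last u q = v & size q <= 2].
Proof.
move=> e_sym; case: eqP => [->|_] /= => [_|ecu]; case: eqP => [->|_] /= => [_|ecv].
- by exists [::].
- by exists [:: v]; rewrite /= ecv.
- by exists [:: c]; rewrite /= e_sym ecu.
- by exists [:: c; v]; rewrite /= e_sym ecu ecv.
Qed.

(** Any two vertices in the closed neighbourhood of [c] are at distance at most
    2.  On a shortest path, all of them thus lie among three consecutive
    vertices, starting with the first one; the other vertices of the path are
    among the at most [d] ones far from [c]. *)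
Lemma distance_le_of_hub (c : V) (d : nat) :
    symmetric e ->
    (forall s : seq V, uniq s ->
       (forall v, v \in s -> ~~ ((v == c) || e c v)) -> size s <= d) ->
  forall x y n, is_distance e x y n -> n <= d + 2.
Proof.
move=> e_sym few_far x y n dxy; have [[p [exp Up last_p size_p]] _] := dxy.
pose near v := (v == c) || e c v.
have far_le : count (predC near) (x :: p) <= d.
  rewrite -size_filter; apply: few_far; first exact: filter_uniq.
  by move=> v; rewrite mem_filter => /andP[].
have near_le : count near (x :: p) <= 3.
  set s := x :: p; set i := find near s.
  have before0 : count near (take i s) = 0.
    by apply/eqP; rewrite -leqn0 leqNgt -has_count has_take_leq ?find_size // ltnn.
  have after0 : count near (drop (i + 3) s) = 0.
    apply/eqP; rewrite -leqn0 leqNgt -has_count; apply/(has_nthP x) => -[k].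
    rewrite size_drop nth_drop => lt_k near_j.
    have lt_js : i + 3 + k < size s by rewrite -ltn_subRL.
    have near_i : near (nth x s i).
      rewrite nth_find //; apply/(has_nthP x); by exists (i + 3 + k).
    have [q [eq_q last_q]] := walk_via_hub e_sym near_i near_j.
    have : i + 3 + k <= i + size q.
      apply: (@geodesic_shortcut x p q) => //; first by rewrite last_p size_p.
      by rewrite -addnA leq_addr addnA.
    rewrite -addnA leq_add2l => le_kq /(leq_trans le_kq).
    by rewrite addSn.
  rewrite -(cat_take_drop i s) count_cat before0 -(cat_take_drop 3 (drop i s)).
  rewrite count_cat drop_drop [3 + i]addnC after0 addn0 add0n.
  by rewrite (leq_trans (count_size _ _)) // size_take_min geq_minl.
have : size (x :: p) <= 3 + d by rewrite -(count_predC near) leq_add.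
by rewrite /= size_p addnC addnS.
Qed.

Lemma diameter_of_bound (x : V) (b : nat) :
    (forall u v n, is_distance e u v n -> n <= b) ->
  exists2 D, is_diameter e D & D <= b.
Proof.
move=> le_b; pose P n := `[< exists u v, is_distance e u v n >].
have exP : exists n, P n.
  by exists 0; apply/asboolP; exists x, x; split=> //; exists [::].
have leP n : P n -> n <= b by move=> /asboolP[u [v /le_b]].
have [D /[dup] /leP le_Db /asboolP PD maxD] := ex_maxnP exP leP.
exists D => //; split=> // u v n duv.
by apply: maxD; apply/asboolP; exists u, v.
Qed.

End Graph.

Section Semigroup.
Variable S : semigroupType.

(** [A] together with all products is a subsemigroup containing [A]. *)
Lemma generates_generator_or_product (A : set S) :
  generates A -> forall s, A s \/ setmul setT setT s.
Proof.
move=> genA s; have : smallest (@subsemigroup S) A s by rewrite genA.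
apply: (@smallest_sub _ _ _ (A `|` setmul setT setT)); last by left.
by move=> _ [a _ [b _ <-]]; right; exists a => //; exists b.
Qed.

(** Moving the central elements [x s] and [t x] past a third factor gives
    [x s t = t x s = s t x]. *)
Lemma ideal_commutes_mul (I : set S) :
    setmul I setT `<=` center S -> setmul setT I `<=` center S ->
  forall x s t, I x -> commute x (s * t)%g.
Proof.
move=> IS SI x s t Ix.
have xs_t : commute (x * s)%g t by apply: IS; exists x => //; exists s.
have tx_s : commute (t * x)%g s by apply: SI; exists t => //; exists x.
by rewrite /commute mulgA xs_t mulgA tx_s mulgA.
Qed.

End Semigroup.

Lemma commuting_graph_sym (S : semigroupType) : symmetric (commuting_graph S).
Proof. by move=> x y; rewrite /commuting_graph eq_sym [X in _ && X]eq_sym. Qed.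

Theorem proposition8 (S : semigroupType) (d : nat) (g : d.-tuple S)
    (I : set S)
    (S_gen : generates [set` g])
    (I_ideal : ideal I)
    (I_noncentral : ~ (I `<=` center S))
    (IS_central : setmul I setT `<=` center S)
    (SI_central : setmul setT I `<=` center S)
    (S_conn : graph_connected (commuting_graph S)) :
  exists2 D : nat, is_diameter (commuting_graph S) D & D <= d + 2.
Proof.
have [x Ix ncx] : exists2 x, I x & ~ center S x.
  by move/existsNP: I_noncentral => [x /not_implyP[]]; exists x.
have ncx' : x \notin center S by apply/negP; rewrite inE.
pose c : noncentral S := exist _ x ncx'.
apply: (diameter_of_bound c).
apply: (distance_le_of_hub (@commuting_graph_sym S) (c := c)) => s Us far.
rewrite -(size_tuple g) -(size_map val).
apply: uniq_leq_size; first by rewrite (map_inj_uniq val_inj).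
move=> _ /mapP[v /far far_v ->].
have [//|[a _ [b _ ab_v]]] := generates_generator_or_product S_gen (val v).
case/negP: far_v; case: eqVneq => //= nvc.
rewrite /commuting_graph eq_sym nvc /=; apply/eqP.
by rewrite -ab_v; apply: (ideal_commutes_mul IS_central SI_central).
Qed.
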